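(* Let $G$ be a connected non-bipartite graph with $s$ vertices and $m$ edges, let $K$ be a field with ${\rm char}(K)\neq 2$, and let $A$ be the incidence matrix of $G$ over $K$. Let $\mathbb{X}$ be the set of points of $\mathbb{P}^{s-1}$ defined by the column vectors of $A$, and let $\upsilon_r(G)$ be the $r$-th weak edge biparticity of $G$. Then $\dim_K(C_\mathbb{X}(1))=s$, $\dim_K(C_\mathbb{X}(d))=m$ for all $d\geq 2$, and $$ \delta_\mathbb{X}(d,r)=\begin{cases} \upsilon_r(G)&\text{if }d=1\text{ and }1\leq r\leq s,\\ r&\text{if } d\geq 2\text{ and }1\leq r\leq m. \end{cases} $$
   Context: Graphs are finite and simple. Let $G$ be a graph with vertices $t_1,\ldots,t_s$ and edges $f_1,\ldots,f_m$. The incidence matrix of $G$ is the $s\times m$ matrix $A=(a_{ij})$ over $K$ with $a_{ij}=1$ if $t_i\in f_j$ and $a_{ij}=0$ otherwise. Let $P_1,\ldots,P_m\in K^s$ be its columns and $\mathbb{X}=\{[P_1],\ldots,[P_m]\}\subset\mathbb{P}^{s-1}$ the corresponding set of points in projective space over $K$. The $r$-th weak edge biparticity $\upsilon_r(G)$ is the minimum number of edges of $G$ whose removal results in a graph with $r$ bipartite connected components, and maybe some non-bipartite connected components (an isolated vertex is a bipartite component). Let $S=K[t_1,\ldots,t_s]=\bigoplus_{d\geq 0}S_d$ with the standard grading (the vertices are identified with the variables). The vanishing ideal $I(\mathbb{X})$ is the graded ideal of $S$ generated by the homogeneous polynomials vanishing at all points of $\mathbb{X}$. For a finite set $F$ of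 homogeneous polynomials, $V_\mathbb{X}(F)$ is the set of common zeros of $F$ in $\mathbb{X}$. For integers $d,r\geq 1$, $$\delta_\mathbb{X}(d,r)=\min\{|\mathbb{X}\setminus V_\mathbb{X}(F)| : F=\{f_i\}_{i=1}^r\subset S_d,\ \dim_K(\{\overline{f}_i\}_{i=1}^r)=r\},$$ where $\overline{f}_i=f_i+I(\mathbb{X})$ and $\dim_K(\{\overline f_i\}_{i=1}^r)$ is the dimension of the $K$-span of these classes in $S/I(\mathbb{X})$. The projective Reed--Muller-type code $C_\mathbb{X}(d)$ is the image of the linear map ${\rm ev}_d\colon S_d\to K^m$, $f\mapsto(f(P_1),\ldots,f(P_m))$. *)

(* Defs.v *)
From HB Require Import structures.
From mathcomp Require Import all_boot all_order all_algebra.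
From mathcomp Require Import finmap.
From mathcomp.multinomials Require Import mpoly.

Set Implicit Arguments.
Unset Strict Implicit.
Unset Printing Implicit Defensive.

Import GRing.Theory.

Local Open Scope ring_scope.

Definition is_minimum (P : nat -> Prop) (n : nat) : Prop :=
  P n /\ forall k, P k -> (n <= k)%N.

Record sgraph (s m : nat) := SGraph {
  edge :> 'I_m -> {set 'I_s};
  edge_inj : injective edge;
  card_edge : forall j, #|edge j| = 2
}.

Section Graphs.
Variables (s m : nat) (G : sgraph s m).

(* Adjacency in the spanning subgraph of G with edge set B. *)
Definition adj (B : {set 'I_m}) : rel 'I_s :=
  fun x y => [exists j in B, G j == [set x; y]].

Definition connected_graph : bool :=
  (0 < s)%N && [forall x, forall y, connect (adj setT) x y].

Definition bipartite_on (e : rel 'I_s) (C : {set 'I_s}) : bool :=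
  [exists U : {set 'I_s},
    [forall x in C, forall y in C, e x y ==> ((x \in U) != (y \in U))]].

Definition bipartite_graph : bool := bipartite_on (adj setT) setT.

Definition components (e : rel 'I_s) : {set {set 'I_s}} :=
  equivalence_partition (connect e) setT.

Definition bipartite_components (e : rel 'I_s) : {set {set 'I_s}} :=
  [set C in components e | bipartite_on e C].

(* The default value m is harmless: #|D| <= m; see weak_edge_biparticityP. *)
Definition weak_edge_biparticity (r : nat) : nat :=
  \big[minn/m]_(D : {set 'I_m} | #|bipartite_components (adj (~: D))| == r)
    #|D|.

Lemma weak_edge_biparticityP r :
  (exists D : {set 'I_m}, #|bipartite_components (adj (~: D))| = r) ->
  is_minimum
    (fun k => exists2 D : {set 'I_m},
       #|bipartite_components (adj (~: D))| = r & #|D| = k)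
    (weak_edge_biparticity r).
Proof.
case=> D0 hD0.
have le_web D : #|bipartite_components (adj (~: D))| = r ->
    (weak_edge_biparticity r <= #|D|)%N.
  move=> hD; rewrite /weak_edge_biparticity.
  elim: (index_enum _) (mem_index_enum D) => // E l IH.
  rewrite inE big_cons => /predU1P [<-|/IH le_l].
    by rewrite hD eqxx geq_minl.
  by case: ifP => // _; rewrite geq_min le_l orbT.
split; last by move=> k [D /le_web le_D <-].
have [D /eqP hD Dmin] := @arg_minnP _ D0
  (fun D : {set 'I_m} => #|bipartite_components (adj (~: D))| == r)
  (fun D => #|D|) (introT eqP hD0).
exists D => //; apply/eqP; rewrite eqn_leq le_web // andbT.
rewrite /weak_edge_biparticity; elim/big_ind: _ => //.
- by rewrite -[leqRHS](card_ord m) max_card.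
- by move=> i j le_i le_j; rewrite leq_min le_i.
Qed.

Definition incidence_mx (K : fieldType) : 'M[K]_(s, m) :=
  \matrix_(i, j) (i \in G j)%:R.

End Graphs.

(* Points of P^(s-1) are represented as lines <[v]>, v != 0, of K^s. *)
Section Points.
Variables (K : fieldType) (s : nat).
Local Notation S := {mpoly K[s]}.
Local Notation point := {vspace 'cV[K]_s}.

Definition eval_at (f : S) (v : 'cV[K]_s) : K := f.@[fun i => v i 0].

Definition vanishes_at (f : S) (p : point) : bool :=
  eval_at f (vpick p) == 0.

Lemma eval_atZ d (f : S) (c : K) (v : 'cV[K]_s) :
  f \is d.-homog -> eval_at f (c *: v) = c ^+ d * eval_at f v.
Proof.
move=> hf; rewrite /eval_at !mevalE mulr_sumr.
rewrite big_seq [RHS]big_seq; apply: eq_bigr => mu hmu.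
rewrite mulrCA; congr (_ * _).
have <- : mdeg mu = d by exact: (dhomog_mf hf hmu).
rewrite mdegE -prodrXr -big_split /=.
by apply: eq_bigr => i _; rewrite mxE exprMn.
Qed.

(* For homogeneous f, the choice of representative is immaterial. *)
Lemma vanishes_at_line d (f : S) (v : 'cV[K]_s) :
  f \is d.-homog -> v != 0 -> vanishes_at f <[v]>%VS = (eval_at f v == 0).
Proof.
move=> hf v0; rewrite /vanishes_at.
have /vlineP [c Ec] : vpick <[v]>%VS \in <[v]>%VS by exact: memv_pick.
have c0 : c != 0.
  apply: contraNneq v0 => c0; move/eqP: Ec.
  by rewrite c0 scale0r vpick0 -subv0 -memvE memv0.
by rewrite Ec (eval_atZ _ _ hf) mulf_eq0 expf_eq0 (negPf c0) andbF.
Qed.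

Definition column_points (m : nat) (A : 'M[K]_(s, m)) : {fset point} :=
  [fset <[col j A]>%VS | j in 'I_m]%fset.

Definition zero_locus (X : {fset point}) (r : nat) (F : 'I_r -> S) :
    {fset point} :=
  [fset p in X | [forall i, vanishes_at (F i) p]]%fset.

Definition ideal_generated (A : S -> Prop) (g : S) : Prop :=
  exists (k : nat) (h a : 'I_k -> S),
    (forall i, A (a i)) /\ g = \sum_i h i * a i.

Definition vanishing_ideal (X : {fset point}) : S -> Prop :=
  ideal_generated
    (fun f => (exists d, f \is d.-homog) /\ forall p, p \in X -> vanishes_at f p).

Definition in_span (r : nat) (F : 'I_r -> S) (g : S) : Prop :=
  exists c : 'I_r -> K, g = \sum_i c i *: F i.

(* The K-span of the classes F_i + N in the quotient S / N has a basis with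
   k elements, namely the classes of b_1, ..., b_k. *)
Definition span_dim_mod (N : S -> Prop) (r : nat) (F : 'I_r -> S) (k : nat) :
    Prop :=
  exists b : 'I_k -> S,
    [/\ forall i, in_span F (b i),
        forall c : 'I_k -> K, N (\sum_i c i *: b i) -> forall i, c i = 0
      & forall g, in_span F g -> exists c : 'I_k -> K,
          N (g - \sum_i c i *: b i)].

(* delta_X(d, r) = n. *)
Definition is_gen_min_dist (X : {fset point}) (d r n : nat) : Prop :=
  is_minimum
    (fun k => exists F : 'I_r -> S,
       [/\ forall i, F i \is d.-homog,
           span_dim_mod (vanishing_ideal X) F r
         & k = #|` (X `\` zero_locus X F)%fset |])
    n.

Definition RM_code (m : nat) (A : 'M[K]_(s, m)) (d : nat) (v : 'rV[K]_m) :
    Prop :=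
  exists2 f : S, f \is d.-homog & v = \row_j eval_at f (col j A).

(* C is a linear subspace of K^m of dimension k. *)
Definition has_dim (m : nat) (C : 'rV[K]_m -> Prop) (k : nat) : Prop :=
  exists2 U : {vspace 'rV[K]_m}, (forall v, v \in U <-> C v) & \dim U = k.

End Points.

(* Main.v *)
Require Import Defs.
From mathcomp Require Import all_boot all_order all_algebra.
From mathcomp Require Import finmap.
From mathcomp.multinomials Require Import mpoly.

Set Implicit Arguments.
Unset Strict Implicit.
Unset Printing Implicit Defensive.

Import GRing.Theory.

Local Open Scope ring_scope.

(** Choosing representatives of the points turns an r-tuple F of forms of
    degree d into the r x m matrix of their values.  A form of degree d lies in
    the vanishing ideal exactly when its values are zero, so the classes of F
    are independent exactly when this matrix is row free, and the points
    outside the zero locus of F are its nonzero columns.  Thus delta(d, r) is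
    the least number of nonzero columns of a row-free r x m matrix whose rows
    are codewords ([gen_min_dist_support]).

    In degree d >= 2 the code is the whole space: if edge j has ends x and y,
    the monomial t_x^(d-1) t_y is 1 at P_j and 0 at every other point
    ([RM_code_full]).  A matrix of rank r has at least r nonzero columns, and a
    partial identity matrix has exactly r.

    In degree 1 a codeword is a linear form a restricted to the edges: its
    value at the edge xy is a_x + a_y.  Fix a set B of edges.  If a vanishes on
    B, then a changes sign along each edge of B; since 2 is invertible, a is
    zero on the non-bipartite components of (V, B), and on a bipartite one it is
    determined up to a scalar, being constant up to sign with opposite signs on
    the two colour classes.  So the forms vanishing on B have dimension b(B),
    the number of bipartite components ([rank_balanced],
    [rank_incidence_mask]).  If B is the set of all edges this is 0,
    because G is connected and not bipartite, so the code has dimension s.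

    It follows that r independent linear forms vanish together on B only if
    b(B) >= r, and that such forms exist when b(B) = r.  The biparticity asks
    for exactly r components, not at least r.  The gap closes because b is s
    minus a rank: one more edge lowers b by at most one
    ([bipartite_components_add_edge]), and b reaches 0 when no edge is missing,
    so edges can be restored one by one until b is exactly r
    ([bipartite_components_exact]), and restoring edges only lowers the number
    of removed ones. *)

(** * Components of a relation and sign-alternating vectors *)

Lemma connect_ind (T : finType) (e : rel T) (x : T) (P : T -> Prop) :
    P x -> (forall y z, connect e x y -> e y z -> P y -> P z) ->
  forall y, connect e x y -> P y.
Proof.
move=> Px Pstep y /connectP[p]; elim/last_ind: p y => [|p z IHp] y /=.
  by move=> _ ->.
rewrite rcons_path last_rcons => /andP[xp ez] ->.
by apply: Pstep ez (IHp _ xp erefl); apply/connectP; exists p.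
Qed.

Lemma mem_components s (e : rel 'I_s) x :
  [set y | connect e x y] \in components e.
Proof. by apply/imsetP; exists x => //; apply/setP => y; rewrite !inE. Qed.

Lemma componentsP s (e : rel 'I_s) C :
  reflect (exists x, C = [set y | connect e x y]) (C \in components e).
Proof.
apply: (iffP idP) => [/imsetP[x _ ->]|[x ->]]; last exact: mem_components.
by exists x; apply/setP => y; rewrite !inE.
Qed.

Lemma bipartite_onP s (e : rel 'I_s) (C : {set 'I_s}) :
  reflect (exists U : {set 'I_s},
    forall x y, x \in C -> y \in C -> e x y -> (x \in U) != (y \in U))
    (bipartite_on e C).
Proof.
apply: (iffP existsP) => -[U hU]; exists U.
  move=> x y xC yC; apply/implyP.
  by move: hU => /forall_inP/(_ _ xC)/forall_inP/(_ _ yC).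
by apply/forall_inP => x xC; apply/forall_inP => y yC; apply/implyP; apply: hU.
Qed.

Section Balance.
Variables (K : fieldType) (s : nat) (e : rel 'I_s).
Hypothesis charK : 2 \notin [pchar K].
Hypothesis symE : ssrbool.symmetric e.

Definition balanced (a : 'rV[K]_s) : Prop :=
  forall x y, e x y -> a 0 x + a 0 y = 0.

Lemma neg_neq (c : K) : c != 0 -> c != - c.
Proof.
apply: contra => /eqP cN; have : c *+ 2 == 0 by rewrite mulr2n {1}cN addNr.
rewrite -mulr_natr mulf_eq0 => /orP[//|two0].
by case/negP: charK; rewrite inE.
Qed.

(** Along paths from x a balanced vector takes only the two values a_x and
    - a_x, which are distinct; they 2-colour the component of x. *)
Lemma balanced_bipartite a x : balanced a -> a 0 x != 0 ->
  bipartite_on e [set y | connect e x y].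
Proof.
move=> bal ax0.
have axN : (- a 0 x == a 0 x) = false by rewrite eq_sym (negPf (neg_neq ax0)).
have pm y : connect e x y -> a 0 y = a 0 x \/ a 0 y = - a 0 x.
  elim/connect_ind: y / => [|y z _ /bal /eqP]; first by left.
  by rewrite addrC addr_eq0 => /eqP -> [] ->; rewrite ?opprK; [right|left].
apply/bipartite_onP; exists [set y | a 0 y == a 0 x] => y z.
rewrite !inE => xy _ /bal /eqP; rewrite addrC addr_eq0 => /eqP ->.
by case: (pm y xy) => ->; rewrite ?opprK eqxx axN.
Qed.

(** A basis of the balanced vectors: for each bipartite component, the vector
    that is 1 and -1 on its two colour classes and 0 elsewhere. *)
Lemma rank_balanced n (Q : 'M[K]_(s, n)) :
    (forall a : 'rV_s, a *m Q = 0 <-> balanced a) ->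
  \rank (kermx Q) = #|bipartite_components e|.
Proof.
move=> kerQ; set k := #|_|; have csym := sym_connect_sym symE.
pose C (i : 'I_k) : {set 'I_s} := enum_val i.
have BC i : C i \in bipartite_components e by exact: enum_valP.
have /fin_all_exists[U hU] i : exists U : {set 'I_s},
    forall x y, x \in C i -> y \in C i -> e x y -> (x \in U) != (y \in U).
  by apply/bipartite_onP; move: (BC i); rewrite inE => /andP[].
have /fin_all_exists[p hp] i : exists x, C i = [set y | connect e x y].
  by apply/componentsP; move: (BC i); rewrite inE => /andP[].
have mem_p i : p i \in C i by rewrite hp inE.
have C_eq i y : y \in C i -> C i = [set z | connect e y z].
  rewrite hp inE => piy; apply/setP => z; rewrite !inE.
  exact: same_connect csym _ _ piy z.
pose sg i x : K := (-1) ^+ (x \in U i).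
have sgK i x : sg i x * sg i x = 1 by rewrite -expr2 sqrr_sign.
(* The rows of M are the basis vectors; column i of P reads off, at the chosen
   vertex p i, the coordinate of a balanced vector on the i-th of them. *)
pose M := \matrix_(i < k, x < s) (sg i x *+ (x \in C i)).
pose P := \matrix_(x < s, i < k) (sg i x *+ (x == p i)).
have mulP l (N : 'M_(l, s)) j i : (N *m P) j i = N j (p i) * sg i (p i).
  rewrite mxE (bigD1 (p i)) //= mxE eqxx mulr1n big1 ?addr0 // => x xp.
  by rewrite mxE (negPf xp) mulr0.
have MP1 : M *m P = 1%:M.
  apply/matrixP => i j; rewrite mulP !mxE.
  have [->|ij] := eqVneq i j; first by rewrite mem_p sgK.
  have [pjCi|_] := boolP (p j \in C i); last by rewrite mul0r.
  case/eqP: ij; apply: enum_val_inj; rewrite -/(C i) -/(C j).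
  by rewrite (C_eq _ _ pjCi) (C_eq _ _ (mem_p j)).
have MQ0 : M *m Q = 0.
  apply/row_matrixP => i; rewrite row_mul row0; apply/kerQ => x y exy.
  rewrite !mxE; have -> : (y \in C i) = (x \in C i).
    by rewrite hp !inE; apply/esym/same_connect_r => //; apply: connect1.
  have [xC|_] := boolP (x \in C i); last by rewrite addr0.
  have yC : y \in C i by rewrite (C_eq _ _ xC) inE connect1.
  have := hU i _ _ xC yC exy; rewrite /sg.
  by case: (x \in U i); case: (y \in U i);
     rewrite //= expr0 expr1 ?addNr ?subrr.
have PMid (a : 'rV_s) : balanced a -> a *m P *m M = a.
  move=> bal; apply/rowP => x; rewrite mxE.
  under eq_bigr => i _ do rewrite mulP mxE.
  have [i xC|noC] := pickP (fun i => x \in C i).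
    rewrite (bigD1 i) //= big1 ?addr0 => [|j ji]; last first.
      have [xCj|_] := boolP (x \in C j); last by rewrite mulr0.
      case/eqP: ji; apply: enum_val_inj; rewrite -/(C i) -/(C j).
      by rewrite (C_eq _ _ xC) (C_eq _ _ xCj).
    rewrite xC mulr1n.
    (* a times the colouring sign is constant on a bipartite component. *)
    suff -> : a 0 (p i) * sg i (p i) = a 0 x * sg i x.
      by rewrite -mulrA sgK mulr1.
    have : connect e (p i) x by move: xC; rewrite hp inE.
    elim/connect_ind: x / {xC} => // y z py eyz ->.
    have yC : y \in C i by rewrite hp inE.
    have zC : z \in C i by rewrite hp inE (connect_trans py) ?connect1.
    have /eqP := bal _ _ eyz; rewrite addr_eq0 => /eqP ->.
    have := hU i _ _ yC zC eyz; rewrite /sg.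
    by case: (y \in U i); case: (z \in U i);
       rewrite //= expr0 expr1 ?mulrN1 ?mulr1 ?opprK.
  rewrite big1 => [|i _]; last by rewrite noC mulr0.
  apply/esym; apply: contraTeq (isT) => ax0.
  have Cx : [set y | connect e x y] \in bipartite_components e.
    by rewrite inE mem_components (balanced_bipartite bal).
  have := noC (enum_rank_in Cx [set y | connect e x y]).
  by rewrite /C enum_rankK_in // inE connect0.
have Mfree : row_free M by apply/row_freeP; exists P.
rewrite -(eqP Mfree); apply/eqP; rewrite eqn_leq !mxrankS //.
  by apply/sub_kermxP.
have -> : kermx Q = kermx Q *m P *m M; last exact: submxMl.
apply/row_matrixP => i; rewrite [RHS]row_mul [row i (_ *m P)]row_mul PMid //.
apply/kerQ.
by rewrite -row_mul mulmx_ker row0.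
Qed.

End Balance.

(** * Generalized minimum distances as supports of matrices *)

Section EvaluationMatrix.
Variables (K : fieldType) (s m : nat) (A : 'M[K]_(s, m)).

Definition col_support r (E : 'M[K]_(r, m)) : {set 'I_m} :=
  [set j | col j E != 0].

Definition ev_mx r (F : 'I_r -> {mpoly K[s]}) : 'M[K]_(r, m) :=
  \matrix_(i, j) eval_at (F i) (col j A).

(** Right multiplication by this matrix erases the columns outside B, so that
    restricting a code to B keeps the matrix sizes and ranks can be compared
    for different B. *)
Definition mask_mx (B : {set 'I_m}) : 'M[K]_m := diag_mx (\row_j (j \in B)%:R).

Lemma mul_mask_mxE r (E : 'M_(r, m)) B i j :
  (E *m mask_mx B) i j = E i j *+ (j \in B).
Proof. by rewrite mul_mx_diag !mxE mulr_natr. Qed.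

Lemma mul_mask_eq0 r (E : 'M_(r, m)) B :
  (E *m mask_mx B == 0) = [disjoint B & col_support E].
Proof.
apply/eqP/pred0P => [EB0 j|dis].
  rewrite /= inE; case: (boolP (j \in B)) => //= jB; apply/negbTE/negPn/eqP.
  by apply/colP => i; have /matrixP/(_ i j) := EB0; rewrite mul_mask_mxE jB !mxE.
apply/matrixP => i j; rewrite mul_mask_mxE mxE; have := dis j; rewrite /= inE.
case: (j \in B) => //= /negbT; rewrite negbK => /eqP/colP/(_ i).
by rewrite !mxE.
Qed.

Lemma rank_mask B : (\rank (mask_mx B) <= #|B|)%N.
Proof.
have -> : mask_mx B = \sum_(j in B) delta_mx j j.
  rewrite /mask_mx diag_mx_sum_delta [RHS]big_mkcond; apply: eq_bigr => j _.
  by rewrite mxE; case: ifP => _; rewrite ?scale1r ?scale0r.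
rewrite -sum1_card; elim/big_rec2: _ => [|j n M _ le_n]; first by rewrite mxrank0.
by rewrite (leq_trans (mxrank_add _ _)) // mxrank_delta leq_add2l.
Qed.

Lemma rank_leq_support r (E : 'M_(r, m)) : (\rank E <= #|col_support E|)%N.
Proof.
have {1}-> : E = E *m mask_mx (col_support E).
  apply/matrixP => i j; rewrite mul_mask_mxE inE.
  by have [/colP/(_ i)|//] := eqVneq (col j E) 0; rewrite !mxE.
exact: leq_trans (mxrankM_maxr _ _) (rank_mask _).
Qed.

Hypotheses (colN0 : forall j, col j A != 0)
           (lineI : injective (fun j => <[col j A]>%VS)).

Let X := column_points A.

Let mem_X j : <[col j A]>%VS \in X.
Proof. by apply/imfsetP; exists j. Qed.

Lemma vanishes_at_column d f j : f \is d.-homog ->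
  vanishes_at f <[col j A]>%VS = (eval_at f (col j A) == 0).
Proof. by move=> hf; rewrite (vanishes_at_line hf). Qed.

Lemma vanishing_ideal_eval g j : vanishing_ideal X g -> eval_at g (col j A) = 0.
Proof.
case=> k [h [a [ha ->]]]; rewrite /eval_at raddf_sum big1 // => i _.
rewrite /= mevalM; have [[d hd] /(_ <[col j A]>%VS)] := ha i.
rewrite (vanishes_at_column _ hd) => /(_ (mem_X j)) /eqP.
by rewrite /eval_at => ->; rewrite mulr0.
Qed.

Lemma vanishing_ideal_homog d g : g \is d.-homog ->
  (forall j, eval_at g (col j A) = 0) -> vanishing_ideal X g.
Proof.
move=> hg g0; exists 1%N, (fun=> 1), (fun=> g); split=> [_|]; last first.
  by rewrite big_ord1 mul1r.
split=> [|p /imfsetP[j _ ->]]; first by exists d.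
by rewrite (vanishes_at_column _ hg) g0.
Qed.

Lemma eval_at_comb r (F : 'I_r -> {mpoly K[s]}) (c : 'I_r -> K) j :
  eval_at (\sum_i c i *: F i) (col j A) = ((\row_i c i) *m ev_mx F) 0 j.
Proof.
rewrite /eval_at raddf_sum mxE; apply: eq_bigr => i _.
by rewrite /= mevalZ !mxE.
Qed.

(** Independence modulo the vanishing ideal can be tested on values because a
    linear combination of the F i is again homogeneous of degree d. *)
Lemma row_free_ev r d (F : 'I_r -> {mpoly K[s]}) :
    (forall i, F i \is d.-homog) ->
  span_dim_mod (vanishing_ideal X) F r <-> row_free (ev_mx F).
Proof.
move=> hF; split=> [[b [bF bI _]]|Efree].
  have /fin_all_exists[c hc] i := bF i.
  have Eb : ev_mx b = (\matrix_(i, k) c i k) *m ev_mx F.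
    apply/row_matrixP => i; rewrite row_mul; apply/rowP => j; rewrite mxE.
    rewrite mxE hc eval_at_comb; congr ((_ *m _) 0 j).
    by apply/rowP => k; rewrite !mxE.
  have bfree : row_free (ev_mx b).
    apply/inj_row_free => v vb0; apply/rowP => i; rewrite mxE.
    apply: (bI (fun i => v 0 i)); apply: (@vanishing_ideal_homog d) => [|j].
      apply: rpred_sum => k _; apply: rpredZ; rewrite hc.
      by apply: rpred_sum => l _; apply: rpredZ; apply: hF.
    rewrite eval_at_comb; have -> : \row_i v 0 i = v.
      by apply/rowP => k; rewrite mxE.
    by rewrite vb0 mxE.
  by rewrite /row_free eqn_leq rank_leq_row -{1}(eqP bfree) Eb mxrankM_maxr.
exists F; split=> [i|c cF i|g [c ->]].
- exists (fun k => (k == i)%:R); rewrite (bigD1 i) //= eqxx scale1r.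
  by rewrite big1 ?addr0 // => k /negPf->; rewrite scale0r.
- have /rowP/(_ i) : \row_i c i = 0; last by rewrite !mxE.
  apply: (row_free_inj Efree); rewrite mul0mx; apply/rowP => j.
  by rewrite -eval_at_comb (vanishing_ideal_eval _ cF) mxE.
- exists c; rewrite subrr; apply: (@vanishing_ideal_homog d) => [|j].
    exact: rpred0.
  by rewrite /eval_at meval0.
Qed.

(** Points correspond to columns because distinct columns span distinct
    lines. *)
Lemma card_off_locus r d (F : 'I_r -> {mpoly K[s]}) :
    (forall i, F i \is d.-homog) ->
  #|` (X `\` zero_locus X F)%fset| = #|col_support (ev_mx F)|.
Proof.
move=> hF.
have -> : (X `\` zero_locus X F)%fset =
    [fset <[col j A]>%VS | j in col_support (ev_mx F)]%fset.
  have locE j : [forall i, vanishes_at (F i) <[col j A]>%VS]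
      = (j \notin col_support (ev_mx F)).
    rewrite inE negbK; apply/forallP/eqP => [F0|/colP E0 i].
      apply/colP => i; rewrite !mxE; apply/eqP.
      by rewrite -(vanishes_at_column _ (hF i)).
    by rewrite (vanishes_at_column _ (hF i)); have := E0 i; rewrite !mxE => ->.
  apply/fsetP => p; rewrite !inE.
  apply/andP/imfsetP => [[pF /imfsetP[j _ Ep]]|[j jE ->]].
    exists j => //; move: pF; rewrite Ep mem_X locE.
    by rewrite negbK.
  by split; rewrite ?locE ?negb_and ?negbK ?mem_X //; apply/orP; right.
by rewrite card_imfset // cardE.
Qed.

Lemma is_minimum_eq (P Q : nat -> Prop) n :
  (forall k, P k <-> Q k) -> is_minimum P n <-> is_minimum Q n.
Proof.
move=> PQ; split=> -[Pn le_n]; split; try exact/PQ; by move=> k /PQ /le_n.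
Qed.

(** This removes polynomials and ideals from the minimum distance: it is the
    r-th generalized Hamming weight of the code. *)
Lemma gen_min_dist_support d r n :
  is_gen_min_dist X d r n <->
  is_minimum (fun k => exists E : 'M[K]_(r, m),
    [/\ row_free E, forall i, RM_code A d (row i E) & k = #|col_support E|]) n.
Proof.
apply: is_minimum_eq => k; split=> [[F [hF /(row_free_ev hF) Ffree ->]]|].
  exists (ev_mx F); rewrite (card_off_locus hF); split=> // i.
  by exists (F i) => //; apply/rowP => j; rewrite !mxE.
case=> E [Efree /fin_all_exists2[F hF EF] ->].
have EE : E = ev_mx F.
  by apply/row_matrixP => i; rewrite EF; apply/rowP => j; rewrite !mxE.
exists F; split=> //; first by apply/(row_free_ev hF); rewrite -EE.
by rewrite (card_off_locus hF) EE.
Qed.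

End EvaluationMatrix.

(** * Codes of linear forms *)

Lemma RM_code1P (K : fieldType) s m (A : 'M[K]_(s, m)) v :
  RM_code A 1 v <-> exists a : 'rV_s, v = a *m A.
Proof.
split=> [[f hf ->]|[a ->]]; last first.
  exists (\sum_i a 0 i *: 'X_i).
    by apply: rpred_sum => i _; apply: rpredZ; rewrite dhomogX /= mdeg1.
  apply/rowP => j; rewrite !mxE /eval_at raddf_sum; apply: eq_bigr => i _.
  by rewrite /= mevalZ mevalXU mxE.
have fE : f = \sum_i f@_U_(i) *: 'X_i.
  apply/mpolyP => mu; rewrite raddf_sum /=.
  under eq_bigr => i _ do rewrite mcoeffZ mcoeffX.
  have [/eqP/mdeg1P[i /eqP->]|mu1] := eqVneq (mdeg mu) 1%N.
    rewrite (bigD1 i) //= eqxx mulr1 big1 ?addr0 // => k ki.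
    by rewrite eq_mnm1 (negPf ki) mulr0.
  rewrite (dhomog_nemf_coeff hf mu1) big1 // => i _.
  have [Emu|_] := eqVneq U_(i)%MM mu; last by rewrite mulr0.
  by rewrite -Emu mdeg1 eqxx in mu1.
exists (\row_i f@_U_(i)); apply/rowP => j; rewrite {1}fE !mxE /eval_at raddf_sum.
by apply: eq_bigr => i _; rewrite /= mevalZ mevalXU !mxE.
Qed.

Lemma has_dim_RM1 (K : fieldType) s m (A : 'M[K]_(s, m)) :
  row_free A -> has_dim (RM_code A 1) s.
Proof.
move=> Afree; pose f : 'Hom('rV[K]_s, 'rV[K]_m) := linfun (mulmxr A).
exists (limg f) => [v|].
  split=> [/memv_imgP[a _ ->]|/RM_code1P[a ->]].
    by apply/RM_code1P; exists a; rewrite lfunE.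
  by have := memv_img f (memvf a); rewrite lfunE.
rewrite limg_dim_eq ?dimvf ?/dim /= ?mul1n //.
suff /eqP-> : lker f == 0%VS by rewrite capv0.
by apply/lker0P => a b; rewrite !lfunE; apply: row_free_inj.
Qed.

(** * The code of an incidence matrix *)

Section IncidenceCode.
Variables (K : fieldType) (s m : nat) (G : sgraph s m).
Local Notation A := (incidence_mx G K).

Lemma edge_ends j : exists x y, G j = [set x; y].
Proof. by have /eqP/cards2P[x [y [_ Gj]]] := card_edge G j; exists x, y. Qed.

Lemma edge_subset j k : G j \subset G k -> j = k.
Proof.
move=> jk; apply: (@edge_inj _ _ G); apply/eqP.
by rewrite eqEcard jk !card_edge.
Qed.

Lemma incidence_col_neq0 j : col j A != 0.
Proof.
have [x [y Gj]] := edge_ends j; apply/eqP => /colP/(_ x)/eqP.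
by rewrite !mxE Gj !inE eqxx oner_eq0.
Qed.

(** The columns have entries 0 and 1, so proportional columns have comparable
    supports. *)
Lemma incidence_line_inj : injective (fun j => <[col j A]>%VS).
Proof.
move=> j k Ejk; have /vlineP[c Ec] : col j A \in <[col k A]>%VS.
  by rewrite -Ejk memv_line.
apply: edge_subset; apply/subsetP => x xj; apply/contraT => xk.
have /colP/(_ x)/eqP := Ec; rewrite !mxE xj (negPf xk) mulr0.
by rewrite oner_eq0.
Qed.

(** Each edge has an indicator form: t_x^(d-1) t_y vanishes at an edge unless
    both x and y lie on it, and a simple graph has one such edge.  Both
    variables occur because d >= 2. *)
Lemma RM_code_full d v : (2 <= d)%N -> RM_code A d v.
Proof.
case: d => [|[|d]] // _.
have /fin_all_exists[x /fin_all_exists[y xyG]] := edge_ends.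
exists (\sum_j v 0 j *: ('X_(x j) ^+ d.+1 * 'X_(y j))).
  apply: rpred_sum => j _; apply: rpredZ.
  have X1 i : 'X_i \is [in K[s], 1.-homog] by rewrite dhomogX /= mdeg1.
  by have := dhomogM (dhomogMn d.+1 (X1 (x j))) (X1 (y j)); rewrite mul1n addn1.
apply/rowP => k; rewrite mxE /eval_at raddf_sum (bigD1 k) //=.
have evalE j : ('X_(x j) ^+ d.+1 * 'X_(y j)).@[fun i => col k A i 0]
    = ((x j \in G k) && (y j \in G k))%:R :> K.
  rewrite mevalM rmorphXn /= !mevalXU !mxE.
  by case: (x j \in G k); case: (y j \in G k);
     rewrite /= ?mulr0 // ?expr1n ?mulr1 // exprS !mul0r.
rewrite mevalZ evalE (xyG k) !inE !eqxx orbT mulr1 big1 ?addr0 // => j jk.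
rewrite mevalZ evalE; case: andP => [[xk yk]|_]; last by rewrite mulr0.
case/eqP: jk; apply: edge_subset; rewrite (xyG j).
by apply/subsetP => z; rewrite !inE => /orP[] /eqP ->.
Qed.

Lemma adj_sym B : ssrbool.symmetric (adj G B).
Proof. by move=> x y; apply: eq_existsb => j; rewrite setUC. Qed.

Lemma mul_incidenceE (a : 'rV[K]_s) j x y :
  G j = [set x; y] -> (a *m A) 0 j = a 0 x + a 0 y.
Proof.
move=> Gj; have xy : x != y.
  by apply/eqP => xy; have := card_edge G j; rewrite Gj xy setUid cards1.
rewrite mxE (bigD1 x) //= (bigD1 y) 1?eq_sym //= !mxE Gj !inE !eqxx orbT.
rewrite !mulr1 big1 ?addr0 // => z /andP[zx zy].
by rewrite mxE Gj !inE (negPf zx) (negPf zy) mulr0.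
Qed.

Hypothesis charK : 2 \notin [pchar K].

(** In terms of codes: the linear forms that vanish on the edges of B. *)
Lemma rank_incidence_mask B :
  \rank (kermx (A *m mask_mx K B)) = #|bipartite_components (adj G B)|.
Proof.
apply: (rank_balanced charK (@adj_sym B)) => a; rewrite mulmxA.
split=> [aB0 x y /exists_inP[j jB /eqP Gj]|bal].
  have /rowP/(_ j) := aB0.
  by rewrite mul_mask_mxE jB (mul_incidenceE _ Gj) mxE.
apply/rowP => j; rewrite mul_mask_mxE [RHS]mxE.
case: (boolP (j \in B)) => //= jB; have [x [y Gj]] := edge_ends j.
rewrite mulr1n (mul_incidenceE _ Gj); apply: bal.
by apply/exists_inP; exists j => //; apply/eqP.
Qed.

Lemma bipartite_components_rank B :
  (#|bipartite_components (adj G B)| + \rank (A *m mask_mx K B) = s)%N.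
Proof. by rewrite -rank_incidence_mask mxrank_ker subnK ?rank_leq_row. Qed.

Lemma bipartite_components_set0 : #|bipartite_components (adj G set0)| = s.
Proof.
have := bipartite_components_rank set0.
have /eqP-> : \rank (A *m mask_mx K set0) == 0%N; last by rewrite addn0.
by rewrite -leqn0 (leq_trans (mxrankM_maxr _ _)) // -(cards0 'I_m) rank_mask.
Qed.

(** Restoring one edge changes one column of the masked incidence matrix, hence
    raises its rank by at most one. *)
Lemma bipartite_components_add_edge B j :
  (#|bipartite_components (adj G B)| <=
   #|bipartite_components (adj G (j |: B))|.+1)%N.
Proof.
have [jB|jB] := boolP (j \in B).
  by rewrite (setUidPr _) ?leqnSn // sub1set.
have maskU : mask_mx K (j |: B) = mask_mx K B + mask_mx K [set j].
  apply/matrixP => i k; rewrite !mxE -mulrnDl !inE; congr (_ *+ _).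
  by have [->|_] := eqVneq i j; rewrite ?(negPf jB) ?addr0 // add0r.
rewrite -(leq_add2r (\rank (A *m mask_mx K B))) bipartite_components_rank.
rewrite -{1}(bipartite_components_rank (j |: B)) maskU mulmxDr.
rewrite addSnnS leq_add2l (leq_trans (mxrank_add _ _)) // -addn1 leq_add2l.
by rewrite (leq_trans (mxrankM_maxr _ _)) // -(cards1 j) rank_mask.
Qed.

Hypotheses (connG : connected_graph G) (nbipG : ~~ bipartite_graph G).

Lemma bipartite_components_setT : #|bipartite_components (adj G setT)| = 0.
Proof.
apply: eq_card0 => C; rewrite inE; apply/negP => /andP[/componentsP[x ->]].
have -> : [set y | connect (adj G setT) x y] = setT.
  apply/setP => y; rewrite !inE; have /andP[_ /forallP/(_ x)/forallP] := connG.
  exact.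
exact/negP.
Qed.

Lemma incidence_row_free : row_free A.
Proof.
have := bipartite_components_rank setT; rewrite bipartite_components_setT add0n.
by move=> rk; rewrite /row_free eqn_leq rank_leq_row -{1}rk mxrankM_maxl.
Qed.

(** Discrete intermediate values: add edges to B one at a time; the number of
    bipartite components cannot jump over r on its way down to 0. *)
Lemma bipartite_components_exact r B : (0 < r)%N ->
    (r <= #|bipartite_components (adj G B)|)%N ->
  exists2 D : {set 'I_m},
    #|bipartite_components (adj G (~: D))| = r & (#|D| <= #|~: B|)%N.
Proof.
move=> r0; have [n] := ubnP #|~: B|; elim: n B => // n IHn B le_n le_r.
have [Er|ne_r] := eqVneq #|bipartite_components (adj G B)| r.
  by exists (~: B); rewrite ?setCK.
have [j jB] : exists j, j \notin B.
  apply/existsP; apply: contraTT le_r; rewrite negb_exists => /forallP allB.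
  have -> : B = setT by apply/setP => j; rewrite inE; apply/negPn/allB.
  by rewrite bipartite_components_setT -ltnNge.
have lt_card : (#|~: (j |: B)| < #|~: B|)%N.
  apply: proper_card; rewrite properE !setCS subsetUr subUset sub1set.
  by rewrite (negPf jB).
have [||D Dr le_D] := IHn (j |: B).
- exact: leq_trans lt_card _.
- rewrite -ltnS (leq_trans _ (bipartite_components_add_edge B j)) //.
  by rewrite ltn_neqAle eq_sym ne_r.
by exists D => //; apply: leq_trans le_D (ltnW lt_card).
Qed.

Lemma gen_min_dist_deg1 r : (1 <= r <= s)%N ->
  is_gen_min_dist (column_points A) 1 r (weak_edge_biparticity G r).
Proof.
case/andP=> r0 rs.
apply/(gen_min_dist_support incidence_col_neq0 incidence_line_inj).
have [|[D Dr cardD] minD] := @weak_edge_biparticityP _ _ G r.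
  have [|D Dr _] := @bipartite_components_exact r set0 r0; last by exists D.
  by rewrite bipartite_components_set0.
set w := weak_edge_biparticity G r in cardD minD *.
(* The edges where a code matrix vanishes leave at least r bipartite
   components, and exactly r can be reached by removing no more edges than the
   support has. *)
have lower (E : 'M[K]_(r, m)) : row_free E -> (forall i, RM_code A 1 (row i E)) ->
    (w <= #|col_support E|)%N.
  move=> Efree codeE; have /fin_all_exists[a Ea] i := (RM_code1P _ _).1 (codeE i).
  pose N := \matrix_i a i; have EN : E = N *m A.
    by apply/row_matrixP => i; rewrite row_mul rowK Ea.
  have [|D' D'r le_D'] := @bipartite_components_exact r (~: col_support E) r0.
    rewrite -rank_incidence_mask -{1}(eqP Efree) EN.
    apply: leq_trans (mxrankM_maxl _ _) (mxrankS _).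
    apply/sub_kermxP/eqP; rewrite mulmxA -EN mul_mask_eq0.
    by rewrite disjoints_subset subxx.
  by rewrite setCK in le_D'; apply: leq_trans le_D'; apply: minD; exists D'.
split; last by move=> k [E [Efree codeE ->]]; apply: lower.
(* Equality: a basis of the forms vanishing on the edges kept by an optimal
   set D of removed edges. *)
pose Q := kermx (A *m mask_mx K (~: D)).
have rkQ : \rank Q = r by rewrite rank_incidence_mask.
have [N Nfree NQ] : exists2 N : 'M[K]_(r, s), row_free N & (N <= Q)%MS.
  by rewrite -rkQ; exists (row_base Q); rewrite ?row_base_free ?eq_row_base.
have Efree : row_free (N *m A).
  by rewrite /row_free mxrankMfree ?incidence_row_free.
have codeE i : RM_code A 1 (row i (N *m A)).
  by apply/RM_code1P; exists (row i N); rewrite row_mul.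
exists (N *m A); split=> //; apply/eqP; rewrite eqn_leq lower //= -cardD.
apply: subset_leq_card; rewrite -[D]setCK -disjoints_subset disjoint_sym.
by rewrite -mul_mask_eq0 -mulmxA; apply/eqP/sub_kermxP.
Qed.

Lemma gen_min_dist_deg_ge2 d r : (2 <= d)%N -> (1 <= r <= m)%N ->
  is_gen_min_dist (column_points A) d r r.
Proof.
move=> d2 /andP[_ rm].
apply/(gen_min_dist_support incidence_col_neq0 incidence_line_inj).
have lower (E : 'M[K]_(r, m)) : row_free E -> (r <= #|col_support E|)%N.
  by move=> /eqP {1}<-; apply: rank_leq_support.
split=> [|k [E [Efree _ ->]]]; last exact: lower.
have Efree : row_free (pid_mx r : 'M[K]_(r, m)).
  by rewrite /row_free rank_pid_mx.
exists (pid_mx r); split=> // [i|]; first exact: RM_code_full.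
apply/eqP; rewrite eqn_leq lower //=.
have /subset_leq_card le_supp :
    col_support (pid_mx r : 'M[K]_(r, m)) \subset widen_ord rm @: setT.
  apply/subsetP => j; rewrite inE; apply: contraNT => jr; apply/eqP/colP => i.
  rewrite !mxE ltn_ord andbT; case: eqP => // Eij.
  by case/imsetP: jr; exists i => //; apply: val_inj.
rewrite (leq_trans le_supp) // (leq_trans (leq_imset_card _ _)) //.
by rewrite cardsT card_ord.
Qed.

End IncidenceCode.

Local Close Scope ring_scope.

Theorem theorem2p10 (K : fieldType) (s m : nat) (G : sgraph s m)
    (charK : 2 \notin [pchar K]%R)
    (connG : connected_graph G) (nbipG : ~~ bipartite_graph G) :
  let A := incidence_mx G K in
  let X := column_points A in
  [/\ has_dim (RM_code A 1) s,
      forall d : nat, 2 <= d -> has_dim (RM_code A d) m,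
      forall r : nat, 1 <= r <= s ->
        is_gen_min_dist X 1 r (weak_edge_biparticity G r)
    & forall d r : nat, 2 <= d -> 1 <= r <= m -> is_gen_min_dist X d r r].
Proof.
split=> [|d d2|r rs|d r d2 rm].
- exact/has_dim_RM1/incidence_row_free.
- exists fullv; last by rewrite dimvf /dim /= mul1n.
  by move=> v; split=> _; [apply: RM_code_full | apply: memvf].
- exact: gen_min_dist_deg1.
- exact: gen_min_dist_deg_ge2.
Qed.
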